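(* Let $m$ and $n$ be positive integers and let $f$ be a monomial in $2m$ real variables $x_0,x_1,\dots,x_{2m-1}$ of total degree $k\ge 1$, such that at least one variable appears in $f$ with an odd exponent. Let $a_1,a_2,\dots,a_m$ be integers such that $l_1a_1+l_2a_2+\cdots+l_ma_m$ is not divisible by $n$ whenever $l_1,\dots,l_m$ are integers with $1\le |l_1|+|l_2|+\cdots+|l_m|\le k$. For $i=1,2,\dots,n$ define $$\mathbf{u}_i=\frac{1}{\sqrt{m}}\left(\cos\Big(\frac{2\pi i a_1}{n}\Big),\ \sin\Big(\frac{2\pi i a_1}{n}\Big),\ \dots,\ \cos\Big(\frac{2\pi i a_m}{n}\Big),\ \sin\Big(\frac{2\pi i a_m}{n}\Big)\right)\in\mathbb{R}^{2m}.$$ Then $\sum_{i=1}^n f(\mathbf{u}_i)=0$. *)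

(* Defs.v *)
From mathcomp Require Import all_boot all_order all_algebra.
(* The notations of mpoly clash with those of mathcomp-analysis. *)
From mathcomp Require Import -(notations) mpoly.
From mathcomp Require Import reals trigo.
Set Implicit Arguments.
Unset Strict Implicit.
Unset Printing Implicit Defensive.
Import GRing.Theory.
Local Open Scope ring_scope.

Lemma half_ord_subproof (m : nat) (j : 'I_(2 * m)) : (j./2 < m)%N.
Proof. by rewrite ltn_half_double -mul2n. Qed.

Definition half_ord (m : nat) (j : 'I_(2 * m)) : 'I_m :=
  Ordinal (half_ord_subproof j).

(* Coordinates 2t and 2t+1 are the cosine and sine attached to [a t]; the
   integers a_1, ..., a_m are indexed from 0. *)
Definition upoint (R : realType) (m n : nat) (a : 'I_m -> int) (i : nat)
    : 'rV[R]_(2 * m) :=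
  (Num.sqrt m%:R)^-1 *:
  \row_(j < 2 * m)
    (let t := 2 * pi * i%:R * (a (half_ord j))%:~R / n%:R in
     if odd j then sin t else cos t).

(* Main.v *)
(** Cosines and sines are both cosines up to a phase, so the product-to-sum
    formula turns a monomial in the coordinates of [u_i] into a combination of
    terms [cos (2 pi i (l . a) / n + phi)] with [|l_1| + ... + |l_m| <= k], and
    such a term sums to [0] over a period as soon as [l != 0].  Let [t] be the
    index of the pair containing a variable of odd exponent.  The terms coming
    from the factors [cos^p sin^q] in the angle [t] have [l_t] of the parity of
    [p + q] and a phase [b pi / 2] with [b] of the parity of [q]; as [p] or [q] is
    odd, [l_t = 0] forces [b] to be odd and such terms vanish.  The factors in
    the other angles do not change [l_t], so only terms with [l_t != 0] remain. *)
Require Import Defs.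
From mathcomp Require Import all_boot all_order all_algebra.
From mathcomp Require Import -(notations) mpoly.
From mathcomp Require Import reals trigo.
From mathcomp Require Import ring zify.
Import Order.TTheory GRing.Theory Num.Theory.
Local Open Scope ring_scope.

Lemma sin_intmul_pi (R : realType) (z : int) : sin (z%:~R * pi) = 0 :> R.
Proof.
elim/int_rect: z => [|p IH|p IH]; first by rewrite mul0r sin0.
- by rewrite -addn1 PoszD intrD mulrDl mul1r sinDpi IH oppr0.
- rewrite -addn1 PoszD opprD intrD mulrDl mulN1r sinB IH sinpi.
  by rewrite mul0r mulr0 subr0.
Qed.

Lemma sinD_intmul_2pi (R : realType) (x : R) (z : int) :
  sin (x + z%:~R * pi *+ 2) = sin x.
Proof.
rewrite sinD sin_mulr2n cos_mulr2n cos2sin2 sin_intmul_pi.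
by rewrite mulr0 mul0rn mulr0 addr0 expr0n /= subr0 mulr2n addrK mulr1.
Qed.

Lemma cos_odd_pihalf (R : realType) (b : int) :
  odd `|b|%N -> cos (b%:~R * (pi / 2)) = 0 :> R.
Proof.
move=> ob; have [z ->] : exists z : int, b = 2 * z + 1.
  by exists (b %/ 2)%Z; lia.
rewrite (_ : _ * _ = z%:~R * pi + pi / 2); last by rewrite intrD intrM; field.
by rewrite cosDpihalf sin_intmul_pi oppr0.
Qed.

Lemma cosM (R : realType) (x y : R) :
  cos x * cos y = 2^-1 * (cos (x + y) + cos (x - y)).
Proof. by rewrite cosD cosB; field. Qed.

Definition freq (R : realType) (n : nat) (z : int) : R :=
  2 * pi * z%:~R / n%:R.

Lemma freqD (R : realType) (n : nat) (y z : int) :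
  freq R n (y + z) = freq R n y + freq R n z.
Proof. by rewrite /freq intrD; ring. Qed.

Lemma freqN (R : realType) (n : nat) (z : int) : freq R n (- z) = - freq R n z.
Proof. by rewrite /freq intrN; ring. Qed.

(** Half the frequency is [pi * z / n]. Reducing [z] modulo [n] leaves an angle strictly between [0]
    and [pi]; the quotient adds a multiple of [pi], which only affects the sign. *)
Lemma sin_half_freq_neq0 (R : realType) (n : nat) (z : int) :
  (0 < n)%N -> ~~ (n%:Z %| z)%Z -> sin (freq R n z / 2) != 0.
Proof.
move=> n0 nz; have n0R : 0 < n%:R :> R by rewrite ltr0n.
have nN : (n%:R : R) != 0 by rewrite gt_eqF.
have -> : freq R n z / 2 = (z %% n)%Z%:~R * pi / n%:R + (z %/ n)%Z%:~R * pi.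
  rewrite /freq {1}(divz_eq z n) intrD intrM -[n%:~R]/(n%:R); field.
  exact: nN.
rewrite sinD sin_intmul_pi mulr0 addr0 mulf_neq0 //; last first.
  by rewrite -normr_gt0 sin0cos1 ?ltr01 // sin_intmul_pi.
have r0 : (0 < (z %% n)%Z)%R.
  rewrite lt_neqAle modz_ge0 ?andbT; last by lia.
  by rewrite eq_sym; apply: contra nz => /eqP/dvdz_mod0P.
have rn : ((z %% n)%Z < n%:Z)%R by apply: ltz_pmod; lia.
rewrite gt_eqF // sin_gt0_pi //.
rewrite divr_gt0 ?mulr_gt0 ?pi_gt0 ?ltr0z //= ltr_pdivrMr // mulrC.
by rewrite ltr_pM2l ?pi_gt0 // -[n%:R]/(n%:Z%:~R) ltr_int.
Qed.

(* Multiplying by [2 * sin (freq R n z / 2)] makes the sum telescope. *)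
Lemma sum_cos_freq (R : realType) (n : nat) (z : int) (phi : R) :
  (0 < n)%N -> ~~ (n%:Z %| z)%Z ->
  \sum_(1 <= i < n.+1) cos (i%:R * freq R n z + phi) = 0.
Proof.
move=> n0 nz; have s0 := sin_half_freq_neq0 R n z n0 nz.
have nN : (n%:R : R) != 0 by rewrite pnatr_eq0; lia.
apply/eqP; rewrite -(mulrI_eq0 _ (mulfI s0)) mulr_sumr.
pose g (i : nat) : R := sin (i%:R * freq R n z + phi - freq R n z / 2) / 2.
rewrite (eq_bigr (fun i => g i.+1 - g i)) => [|i _]; last first.
  rewrite /g (_ : i.+1%:R * _ + phi - _
                  = i%:R * freq R n z + phi + freq R n z / 2).
    by rewrite sinD sinB; field.
  by rewrite -natr1; field.
rewrite telescope_sumr // subr_eq0 /g; apply/eqP; congr (_ / 2).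
(* Over [n] steps the argument of [g] grows by [n * freq R n z], that is [2 * pi * z], so the two
   end terms agree. *)
rewrite -[RHS](sinD_intmul_2pi R _ z); congr sin.
rewrite -natr1 /freq -mulr_natr; field.
exact: nN.
Qed.

Definition unit_idx (m : nat) (t : 'I_m) (j : 'I_m) : int := (j == t)%:Z.

Lemma sum_unit_idx (m : nat) (t : 'I_m) (F : 'I_m -> int) :
  \sum_j unit_idx m t j * F j = F t.
Proof.
rewrite (bigD1 t) //= /unit_idx eqxx mul1r big1 ?addr0 // => j /negPf ->.
by rewrite mul0r.
Qed.

Lemma sum_abszD_unit_idx (m : nat) (t : 'I_m) (c : int) (l : 'I_m -> int) :
  (\sum_j `|(l j + c * unit_idx m t j)%R|%N <= \sum_j `|l j|%N + `|c|%N)%N.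
Proof.
rewrite (bigD1 t) //= [X in (_ <= X + _)%N](bigD1 t) //=.
rewrite (eq_bigr (fun j => `|l j|%N)); first by rewrite /unit_idx eqxx; lia.
by move=> j /negPf jt; rewrite /unit_idx jt mulr0 addr0.
Qed.

(* [d] is the degree of [G]: the bound leaves room for [l] to grow by [d] when
   the factors of [G] are absorbed into the cosine. *)
Definition nulls_at (R : realType) (m n k : nat) (a : 'I_m -> int) (t : 'I_m)
    (d : nat) (G : nat -> R) :=
  forall (l : 'I_m -> int) (phi : R), l t != 0 -> (\sum_j `|l j|%N + d <= k)%N ->
  \sum_(1 <= i < n.+1) cos (i%:R * freq R n (\sum_j l j * a j) + phi) * G i = 0.

(** By [cosM] the new factor turns [l] into [l] plus or minus the unit vector at [s]. As [s != t],
    the entry at [t] stays nonzero, and the weight grows by at most 1, which [d.+1] allows for. *)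
Lemma nulls_at_mulcos (R : realType) (m n k : nat) (a : 'I_m -> int)
    (t s : 'I_m) (d : nat) (G : nat -> R) (psi : R) :
  s != t -> nulls_at R m n k a t d G ->
  nulls_at R m n k a t d.+1 (fun i => cos (i%:R * freq R n (a s) + psi) * G i).
Proof.
move=> st HG l phi lt0 ld.
pose l' (c : int) j := l j + c * unit_idx m s j.
have l'E c : \sum_j l' c j * a j = \sum_j l j * a j + c * a s.
  rewrite -(sum_unit_idx m s a) mulr_sumr -big_split /=.
  by apply: eq_bigr => j _; rewrite /l'; ring.
have l't c : l' c t != 0 by rewrite /l' /unit_idx [t == s]eq_sym (negPf st) mulr0 addr0.
have l'd c : `|c|%N = 1%N -> (\sum_j `|l' c j|%N + d <= k)%N.
  move=> c1; apply: leq_trans ld; rewrite addnS -addSn leq_add2r -addn1 -c1.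
  exact: sum_abszD_unit_idx.
have H1 := HG (l' 1) (phi + psi) (l't 1) (l'd 1 erefl).
have H2 := HG (l' (-1)) (phi - psi) (l't (-1)) (l'd (-1) erefl).
have := congr2 (fun x y : R => 2^-1 * (x + y)) H1 H2.
rewrite addr0 mulr0 => H; rewrite -[RHS]H -big_split /= mulr_sumr; apply: eq_bigr => i _.
rewrite -mulrDl [LHS]mulrA cosM [RHS]mulrA !l'E mul1r mulN1r !freqD freqN.
by congr (_ * (cos _ + cos _) * _); ring.
Qed.

Lemma nulls_at_mulcosX (R : realType) (m n k : nat) (a : 'I_m -> int)
    (t s : 'I_m) (d : nat) (G : nat -> R) (psi : R) (N : nat) :
  s != t -> nulls_at R m n k a t d G ->
  nulls_at R m n k a t (N + d)
    (fun i => cos (i%:R * freq R n (a s) + psi) ^+ N * G i).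
Proof.
move=> st HG; elim: N => [|N IH] l phi lt0 ld.
  under eq_bigr do rewrite expr0 mul1r; exact: HG.
under eq_bigr do rewrite exprS -mulrA.
exact: (nulls_at_mulcos R m n k a t s _ _ psi st IH).
Qed.

(* [p] counts the factors of [G] in the angle of [z], and [q] those among them
   that are sines; the parity condition excludes a constant term in the product
   of the cosine with these factors. *)
Definition nulls_parity (R : realType) (n k : nat) (z : int) (d q p : nat)
    (G : nat -> R) :=
  forall l b : int, odd `|(b + q%:Z)%R|%N || odd `|(l + p%:Z)%R|%N -> (`|l|%N + d <= k)%N ->
  \sum_(1 <= i < n.+1)
    cos (i%:R * freq R n (l * z) - b%:~R * (pi / 2)) * G i = 0.

(** For [l != 0], take [l] times the unit vector at [t]. For [l = 0], the parity condition makes [b]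
    odd and every cosine vanishes. *)
Lemma nulls_at_parity (R : realType) (m n k : nat) (a : 'I_m -> int)
    (t : 'I_m) (d : nat) (G : nat -> R) :
  nulls_at R m n k a t d G -> nulls_parity R n k (a t) d 0 0 G.
Proof.
move=> HG l b; rewrite !addr0 => pr ld.
have [l0|ln0] := eqVneq l 0.
  rewrite l0 /= orbF in pr; apply: big1 => i _.
  by rewrite l0 mul0r /freq mulr0 mul0r mulr0 add0r cosN cos_odd_pihalf // mul0r.
have H := HG (fun j => 0 + l * unit_idx m t j) (- (b%:~R * (pi / 2))).
rewrite (_ : \sum_j _ = l * a t) in H; last first.
  rewrite -(sum_unit_idx m t a) mulr_sumr.
  by apply: eq_bigr => j _; rewrite add0r mulrA.
apply: H; first by rewrite /unit_idx eqxx add0r mulr1.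
apply: leq_trans ld; rewrite leq_add2r.
by apply: leq_trans (sum_abszD_unit_idx m t l (fun=> 0)) _; rewrite big1.
Qed.

(** The flag [o] marks a sine. By [cosM], [l] moves by 1 and [b] by [o] in either direction, so the
    increments of [p] and [q] preserve both parities. *)
Lemma nulls_parity_mulcos (R : realType) (n k : nat) (z : int) (d q p : nat)
    (G : nat -> R) (o : bool) :
  nulls_parity R n k z d q p G ->
  nulls_parity R n k z d.+1 (o + q) p.+1
    (fun i => cos (i%:R * freq R n z - o%:R * (pi / 2)) * G i).
Proof.
move=> HG l b pr ld.
have H1 := HG (l + 1) (b + o%:Z) ltac:(lia) ltac:(lia).
have H2 := HG (l - 1) (b - o%:Z) ltac:(lia) ltac:(lia).
have := congr2 (fun x y : R => 2^-1 * (x + y)) H1 H2.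
rewrite addr0 mulr0 => H; rewrite -[RHS]H -big_split /= mulr_sumr; apply: eq_bigr => i _.
rewrite -mulrDl [LHS]mulrA cosM [RHS]mulrA.
rewrite [(l + 1) * z]mulrDl [(l - 1) * z]mulrDl mul1r mulN1r !freqD freqN.
rewrite !intrD intrN -[(o%:Z)%:~R]/(o%:R).
by congr (_ * (cos _ + cos _) * _); ring.
Qed.

Lemma nulls_parity_mulcosX (R : realType) (n k : nat) (z : int) (d q p : nat)
    (G : nat -> R) (o : bool) (N : nat) :
  nulls_parity R n k z d q p G ->
  nulls_parity R n k z (N + d) (N * o + q) (N + p)
    (fun i => cos (i%:R * freq R n z - o%:R * (pi / 2)) ^+ N * G i).
Proof.
move=> HG; elim: N => [|N IH] l b pr ld.
  by under eq_bigr do rewrite expr0 mul1r; apply: HG.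
under eq_bigr do rewrite exprS -mulrA.
apply: (nulls_parity_mulcos R n k z _ _ _ _ o IH) => //.
by rewrite mulSn -addnA in pr.
Qed.

(** Sines are written as shifted cosines so that one multiplication lemma serves both kinds of
    coordinates. *)
Definition ucoord (R : realType) (m n : nat) (a : 'I_m -> int)
    (j : 'I_(2 * m)) (i : nat) : R :=
  cos (i%:R * freq R n (a (half_ord j)) - (odd j)%:R * (pi / 2)).

Lemma upointE (R : realType) (m n : nat) (a : 'I_m -> int) (i : nat)
    (j : 'I_(2 * m)) :
  upoint R n a i 0 j = (Num.sqrt m%:R)^-1 * ucoord R m n a j i.
Proof.
rewrite !mxE /ucoord /=; congr (_ * _).
rewrite (_ : 2 * pi * _ * _ / _ = i%:R * freq R n (a (half_ord j))).
  by case: odd; rewrite ?mul1r ?cosBpihalf // mul0r subr0.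
by rewrite /freq; ring.
Qed.

(** Induction on [r]: the empty product is where [ha] enters, as [l t != 0] makes the weight
    positive; each further factor is absorbed by [nulls_at_mulcosX]. *)
Lemma nulls_at_prod (R : realType) (m n k : nat) (a : 'I_m -> int) (t : 'I_m)
    (e : 'I_(2 * m) -> nat) (r : seq 'I_(2 * m)) :
  (0 < n)%N ->
  (forall l : 'I_m -> int, (1 <= \sum_(j < m) `|l j|%N <= k)%N ->
     ~~ (n%:Z %| \sum_(j < m) l j * a j)%Z) ->
  nulls_at R m n k a t (\sum_(j <- r | half_ord j != t) e j)
    (fun i => \prod_(j <- r | half_ord j != t) ucoord R m n a j i ^+ e j).
Proof.
move=> n0 ha; elim: r => [|j r IH].
  move=> l phi lt0; rewrite big_nil addn0 => lk.
  under eq_bigr do rewrite big_nil mulr1.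
  apply: sum_cos_freq => //; apply: ha; rewrite lk andbT (bigD1 t) //=.
  by rewrite addn_gt0 absz_gt0 lt0.
move=> l phi lt0; rewrite big_cons => lk.
under eq_bigr do rewrite big_cons.
case: ifP lk => [jt|_] lk; last exact: IH.
exact: (nulls_at_mulcosX R m n k a t _ _ _ _ _ jt IH).
Qed.

Lemma twin_ord_subproof (m : nat) (j : 'I_(2 * m)) :
  (j./2.*2 + ~~ odd j < 2 * m)%N.
Proof. by have := ltn_ord j; lia. Qed.

Definition twin_ord (m : nat) (j : 'I_(2 * m)) : 'I_(2 * m) :=
  Ordinal (twin_ord_subproof m j).

Lemma odd_twin_ord (m : nat) (j : 'I_(2 * m)) :
  odd (twin_ord m j) = ~~ odd j.
Proof. by rewrite /= oddD odd_double; case: (odd j). Qed.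

Lemma half_twin_ord (m : nat) (j : 'I_(2 * m)) :
  half_ord (twin_ord m j) = half_ord j.
Proof. by apply: val_inj => /=; lia. Qed.

Lemma eq_half_ord (m : nat) (j0 j : 'I_(2 * m)) :
  (half_ord j == half_ord j0) = (j == j0) || (j == twin_ord m j0).
Proof. by rewrite -!val_eqE /=; lia. Qed.

(** Stated for any commutative law, as it splits both the product of coordinates and the sum of
    exponents. *)
Lemma big_half_ord (T : Type) (idx : T) (op : Monoid.com_law idx) (m : nat)
    (j0 : 'I_(2 * m)) (F : 'I_(2 * m) -> T) :
  \big[op/idx]_j F j = op (F j0) (op (F (twin_ord m j0))
    (\big[op/idx]_(j | half_ord j != half_ord j0) F j)).
Proof.
have tw : twin_ord m j0 != j0.
  by apply/eqP => E; have := odd_twin_ord m j0; rewrite E; case: odd.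
rewrite (bigD1 j0) //= (bigD1 (twin_ord m j0)) //=.
by congr (op _ (op _ _)); apply: eq_bigl => j; rewrite eq_half_ord negb_or.
Qed.

Theorem theorem6 (R : realType) (m n k : nat) (hm : (0 < m)%N) (hn : (0 < n)%N)
    (hk : (1 <= k)%N)
    (f : mpoly (2 * m) R)
    (c : R) (hc : c != 0) (e : multinom (2 * m))
    (hf : f = c *: mpolyX R e)
    (hdeg : mdeg e = k)
    (hodd : exists j : 'I_(2 * m), odd (e j))
    (a : 'I_m -> int)
    (ha : forall l : 'I_m -> int,
        (1 <= \sum_(j < m) `|l j|%N <= k)%N ->
        ~~ (n%:Z %| \sum_(j < m) l j * a j)%Z) :
  \sum_(1 <= i < n.+1) meval (upoint R n a i 0) f = 0.
Proof.
have [j0 oj0] := hodd.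
rewrite hf; under eq_bigr do rewrite mevalZ mevalX.
rewrite -mulr_sumr.
under eq_bigr do under eq_bigr do rewrite upointE exprMn.
under eq_bigr do rewrite big_split /=.
rewrite -mulr_sumr.
suff -> : \sum_(1 <= i < n.+1) \prod_j ucoord R m n a j i ^+ e j = 0.
  by rewrite !mulr0.
under eq_bigr do rewrite (big_half_ord _ _ _ m j0) /=.
have H0 := nulls_at_parity R m n k a (half_ord j0) _ _
  (nulls_at_prod R m n k a (half_ord j0) e (index_enum _) hn ha).
have H1 := nulls_parity_mulcosX R n k _ _ _ _ _ (odd (twin_ord m j0))
  (e (twin_ord m j0)) H0.
have H2 := nulls_parity_mulcosX R n k _ _ _ _ _ (odd j0) (e j0) H1.
(* With [l = b = 0] the cosine is 1 and the bare monomial remains. *)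
have := H2 0 0; rewrite mul0r /freq mulr0 !mul0r => H.
rewrite -[RHS]H; last first.
- by rewrite absz0 add0n -hdeg mdegE (big_half_ord _ _ _ m j0).
(* If [j0] is a sine, the sine count is odd. Otherwise that count is the exponent of the twin: it is
   odd, or else the total exponent of the pair is. *)
- rewrite !add0r !addn0 odd_twin_ord !absz_nat !oddD !oddM oj0.
  by case: (odd j0); case: (odd (e _)).
apply: eq_bigr => i _; rewrite mulr0 subr0 cos0 mul1r.
by rewrite /ucoord half_twin_ord.
Qed.
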